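(* Let $n\ge 4$ be an integer, let $U\subseteq\mathbb{R}$ be an open interval, let $f_0,\dots,f_n\colon U\to\mathbb{R}$ be differentiable functions and $F\colon U\to\mathbb{R}$ a three-times differentiable function such that for all $u\in U$ $$f_n(u)\neq 0,\qquad F(u)\neq 0,\qquad F'(u)=|f_n(u)|^{\frac1{n-1}},$$ and let $g(u)=\frac{(n-2)F(u)}{(n-1)F'(u)}$. Let $\varepsilon,\nu\in\{1,-1\}$ and $a\in\mathbb{R}$ be constants such that $|f_n|=\varepsilon f_n$ and $|F|=\nu F$ on $U$. Consider the system of identities on $U$ $$(\ast)\quad\begin{cases}-a^2g+f_0'g+af_1g-f_0g'+2f_0=0,\\ a(1-2g')+f_1'g+2af_2g+f_1=0,\\ -g''+f_2'g+3af_3g+f_2g'=0,\\ f_k'g+(k+1)af_{k+1}g+(k-1)f_kg'+(2-k)f_k=0\quad(3\le k\le n-1).\end{cases}$$ Then $f_0,\dots,f_n,F,g$ satisfy $(\ast)$ if and only if there exist real constants $b_k$ and functions $A_k,B_k\colon U\to\mathbb{R}$ $(0\le k\le n)$, where $b_n=\varepsilon\left(\frac{n-1}{n-2}\right)^{1-n}$, $A_n$ is constant $0$, $$A_k(u)=\sum_{i=1}^{n-k}(-\nu)^i\binom{k+i}{i}a^i\,b_{k+i}\,|F(u)|^{\frac{i(n-1)}{n-2}}\qquad(0\le k\le n-1),$$ and $$B_k(u)=A_k(u)\quad(3\le k\le n),\qquad B_2(u)=\nu A_2(u),$$ $$B_1(u)=A_1(u)-a|F(u)|^{\frac{n-1}{n-2}}\bigl(2b_2(1-\nu)+1\bigr),$$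 $$B_0(u)=A_0(u)+a^2\bigl(1+b_2(1-\nu)\bigr)\nu|F(u)|^{\frac{2(n-1)}{n-2}},$$ such that for all $u\in U$ $$f_k(u)=\bigl(b_k+B_k(u)\bigr)\left(\frac{n-1}{n-2}\right)^{k-1}|F(u)|^{\frac{k-n}{n-2}}\bigl(F'(u)\bigr)^{k-1}\qquad(0\le k\le n,\ k\neq 2),$$ $$f_2(u)=\bigl(b_2+B_2(u)\bigr)\frac{n-1}{n-2}\cdot\frac{F'(u)}{F(u)}+\frac{F'(u)}{F(u)}-\frac{F''(u)}{F'(u)}.$$ In particular, if $a=0$, then $B_k(u)=0$ for all $u\in U$ $(0\le k\le n)$, and thus $f_0,\dots,f_n,F,g$ satisfy $(\ast)$ if and only if there exist real constants $b_k'$ $(0\le k\le n)$ such that $$f_k(u)=b_k'\,|F(u)|^{\frac{k-n}{n-2}}\bigl(F'(u)\bigr)^{k-1}\quad(0\le k\le n,\ k\ne2),\qquad f_2(u)=b_2'\frac{F'(u)}{F(u)}-\frac{F''(u)}{F'(u)}.$$ Further, if $F$ is positive on $U$, then the functions $B_k$ above are $$B_k(u)=A_k(u)\ (2\le k\le n),\quad B_1(u)=A_1(u)-a\,F(u)^{\frac{n-1}{n-2}},\quad B_0(u)=A_0(u)+a^2F(u)^{\frac{2(n-1)}{n-2}}.$$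
   Context: Primes on $f_k,F,g$ denote differentiation with respect to $u$; the primes in $b_k'$ are only part of the name of the constants. *)

(* Defs.v *)
From Stdlib Require Export Reals.
From Coquelicot Require Export Coquelicot.
Open Scope R_scope.

(* Functions on an interval U are represented by total functions R -> R of
   which only the values on U are constrained; as U is open, [Derive] at a point
   of U depends only on those values. Families indexed by 0, ..., n are functions
   of nat of which only the indices k <= n are used. *)

(* The endpoints may be infinite. *)
Definition is_open_interval (U : R -> Prop) : Prop :=
  exists l r : Rbar, forall x : R, U x <-> Rbar_lt l x /\ Rbar_lt x r.

(* [ex_derive_n h m u] only says that [Derive_n h (m - 1)] is differentiable at
   u, hence the quantification over all orders m <= p. *)
Definition times_differentiable_on (p : nat) (U : R -> Prop) (h : R -> R) : Prop :=
  forall u : R, U u -> forall m : nat, (m <= p)%nat -> ex_derive_n h m u.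

Definition satisfies_system (n : nat) (U : R -> Prop) (a : R)
    (f : nat -> R -> R) (g : R -> R) : Prop :=
  forall u : R, U u ->
    - a ^ 2 * g u + Derive (f 0%nat) u * g u + a * f 1%nat u * g u
      - f 0%nat u * Derive g u + 2 * f 0%nat u = 0
    /\ a * (1 - 2 * Derive g u) + Derive (f 1%nat) u * g u
       + 2 * a * f 2%nat u * g u + f 1%nat u = 0
    /\ - Derive_n g 2 u + Derive (f 2%nat) u * g u + 3 * a * f 3%nat u * g u
       + f 2%nat u * Derive g u = 0
    /\ (forall k : nat, (3 <= k <= n - 1)%nat ->
         Derive (f k) u * g u + (INR k + 1) * a * f (S k) u * g u
         + (INR k - 1) * f k u * Derive g u + (2 - INR k) * f k u = 0).

(* [Rpower] is used for real exponents of positive bases, [powerRZ] for integer,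
   possibly negative, exponents. [Binomial.C] is the binomial coefficient ([C]
   alone is Coquelicot's type of complex numbers). *)
Definition coefficient_functions (n : nat) (U : R -> Prop) (a eps nu : R)
    (F : R -> R) (b : nat -> R) (A B : nat -> R -> R) : Prop :=
  b n = eps * powerRZ ((INR n - 1) / (INR n - 2)) (1 - Z.of_nat n)
  /\ forall u : R, U u ->
       A n u = 0
    /\ (forall k : nat, (k <= n - 1)%nat ->
         A k u = sum_n_m (fun i : nat =>
                   (- nu) ^ i * Binomial.C (k + i) i * a ^ i * b (k + i)%nat
                   * Rpower (Rabs (F u)) (INR i * (INR n - 1) / (INR n - 2)))
                 1 (n - k))
    /\ (forall k : nat, (3 <= k <= n)%nat -> B k u = A k u)
    /\ B 2%nat u = nu * A 2%nat u
    /\ B 1%nat u = A 1%nat u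
         - a * Rpower (Rabs (F u)) ((INR n - 1) / (INR n - 2))
           * (2 * b 2%nat * (1 - nu) + 1)
    /\ B 0%nat u = A 0%nat u
         + a ^ 2 * (1 + b 2%nat * (1 - nu)) * nu
           * Rpower (Rabs (F u)) (2 * (INR n - 1) / (INR n - 2)).

Definition general_solution (n : nat) (U : R -> Prop) (f : nat -> R -> R)
    (F : R -> R) (b : nat -> R) (B : nat -> R -> R) : Prop :=
  forall u : R, U u ->
    (forall k : nat, (k <= n)%nat -> k <> 2%nat ->
       f k u = (b k + B k u)
               * powerRZ ((INR n - 1) / (INR n - 2)) (Z.of_nat k - 1)
               * Rpower (Rabs (F u)) ((INR k - INR n) / (INR n - 2))
               * powerRZ (Derive F u) (Z.of_nat k - 1))
    /\ f 2%nat u = (b 2%nat + B 2%nat u) * ((INR n - 1) / (INR n - 2))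
                   * (Derive F u / F u)
                   + Derive F u / F u - Derive_n F 2 u / Derive F u.

Definition special_solution (n : nat) (U : R -> Prop) (f : nat -> R -> R)
    (F : R -> R) (b' : nat -> R) : Prop :=
  forall u : R, U u ->
    (forall k : nat, (k <= n)%nat -> k <> 2%nat ->
       f k u = b' k
               * Rpower (Rabs (F u)) ((INR k - INR n) / (INR n - 2))
               * powerRZ (Derive F u) (Z.of_nat k - 1))
    /\ f 2%nat u = b' 2%nat * (Derive F u / F u) - Derive_n F 2 u / Derive F u.

(* Main.v *)
Require Import Defs.
From Stdlib Require Import Reals Lra Lia Factorial.
From Coquelicot Require Import Coquelicot.
Open Scope R_scope.

(** With [c = (n-1)/(n-2)] and [T = |F|^c] one has [g = F / (c F')], hence
    [T' = T / g]. After the substitution [h_k = f_k T^(2-k) (nu g)^(k-1)] for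
    [k <> 2] and [h_2 = f_2 g - g'], every term without the factor [a], except
    [h_k'], cancels: the [k]-th equation becomes [h_k' = r_k (h_(k+1), T) T']
    with [r_k] affine. So each [h_k] is an antiderivative of a polynomial in [T],
    and the constants [b_k] appear by descending induction from [h_n = b_n]. *)

(** * The sums [A_k] and [B_k] as polynomials in [x = T] *)

Definition shift_sum (n : nat) (nu a : R) (b : nat -> R) (k : nat) (x : R) : R :=
  sum_n_m (fun i : nat =>
    (- nu) ^ i * Binomial.C (k + i) i * a ^ i * b (k + i)%nat * x ^ i) 1 (n - k).

Definition shift (n : nat) (nu a : R) (b : nat -> R) (k : nat) (x : R) : R :=
  match k with
  | 0%nat => shift_sum n nu a b 0 x
             + a ^ 2 * (1 + b 2%nat * (1 - nu)) * nu * x ^ 2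
  | 1%nat => shift_sum n nu a b 1 x - a * x * (2 * b 2%nat * (1 - nu) + 1)
  | 2%nat => nu * shift_sum n nu a b 2 x
  | _ => shift_sum n nu a b k x
  end.

(** These are the affine [r_k], with [y] standing for [h_(k+1)] and [x] for [T]. Indices 1 and 2
    carry no [nu] because [h_2] is built with [g], not with [nu g]. *)
Definition rate (nu a : R) (k : nat) (y x : R) : R :=
  match k with
  | 0%nat => nu * (a ^ 2 * x - a * y)
  | 1%nat => - a * (1 + 2 * y)
  | 2%nat => - 3 * a * y
  | _ => - nu * (INR k + 1) * a * y
  end.

(** Both sides equal [(k + j + 1)! / (j! k!)]. The factor produced by differentiating [x ^ S j] thus
    becomes [k + 1], independent of [j]. *)
Lemma C_absorption (k j : nat) :
  INR (S j) * Binomial.C (k + S j) (S j) = INR (S k) * Binomial.C (S k + j) j.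
Proof.
  unfold Binomial.C.
  replace (k + S j - S j)%nat with k by lia.
  replace (S k + j - j)%nat with (S k) by lia.
  replace (k + S j)%nat with (S k + j)%nat by lia.
  rewrite (fact_simpl j), (fact_simpl k), !mult_INR.
  assert (INR (S j) <> 0) by (apply not_0_INR; lia).
  assert (INR (S k) <> 0) by (apply not_0_INR; lia).
  assert (INR (fact j) <> 0) by apply INR_fact_neq_0.
  assert (INR (fact k) <> 0) by apply INR_fact_neq_0.
  field; tauto.
Qed.

Lemma shift_sum_n (n : nat) (nu a : R) (b : nat -> R) (x : R) :
  shift_sum n nu a b n x = 0.
Proof.
  unfold shift_sum; rewrite sum_n_m_zero by lia; reflexivity.
Qed.

(** By absorption the derivative of term [j + 1] is the common factor times term [j] of the sum for
    [S k]. Term [j = 0] gives the isolated [b (S k)], as [shift_sum] starts at 1. *)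
Lemma is_derive_shift_sum (n : nat) (nu a : R) (b : nat -> R) (k : nat) (x : R) :
  (k < n)%nat ->
  is_derive (shift_sum n nu a b k) x
    (- nu * (INR k + 1) * a * (b (S k) + shift_sum n nu a b (S k) x)).
Proof.
  intros Hk.
  apply is_derive_ext with (f := fun y => sum_n (fun j : nat =>
    (- nu) ^ S j * Binomial.C (k + S j) (S j) * a ^ S j * b (k + S j)%nat * y ^ S j)
    (n - S k)).
  { intros y; unfold shift_sum, sum_n.
    replace (n - k)%nat with (S (n - S k)) by lia.
    exact (sum_n_m_S (fun i : nat => (- nu) ^ i * Binomial.C (k + i) i * a ^ i
      * b (k + i)%nat * y ^ i) 0 (n - S k)). }
  assert (E : - nu * (INR k + 1) * a * (b (S k) + shift_sum n nu a b (S k) x)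
    = sum_n (fun j : nat => (- nu) ^ S j * Binomial.C (k + S j) (S j) * a ^ S j
        * b (k + S j)%nat * (INR (S j) * x ^ j)) (n - S k)).
  { transitivity (sum_n_m (fun j : nat => mult (- nu * (INR k + 1) * a)
      ((- nu) ^ j * Binomial.C (S k + j) j * a ^ j * b (S k + j)%nat * x ^ j))
      0 (n - S k)).
    - rewrite sum_n_m_mult_l, (sum_Sn_m _ 0) by lia.
      unfold shift_sum, plus, mult; simpl.
      rewrite !Nat.add_0_r, C_n_0.
      rewrite !Rmult_1_r, !Rmult_1_l; reflexivity.
    - apply sum_n_m_ext; intros j; unfold mult; simpl mult.
      match goal with |- ?l = ?r => change (@eq R l r) end.
      transitivity ((- nu) ^ S j * a ^ S j * b (k + S j)%nat * x ^ j
        * (INR (S j) * Binomial.C (k + S j) (S j))).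
      + rewrite C_absorption.
        replace (k + S j)%nat with (S k + j)%nat by lia.
        rewrite (S_INR k). simpl. ring.
      + ring. }
  rewrite E.
  apply (is_derive_sum_n (V := R_NormedModule)).
  intros j _; auto_derive; [exact I|]. simpl; ring.
Qed.

(** The corrections in [shift] repair the low indices. At 2 the factor [nu] meets [- nu] and leaves
    [-1]. At 1 the linear term turns [nu * b 2] into [b 2] and supplies the constant 1 of [rate]. At
    0 the quadratic term supplies [a ^ 2 * x] and compensates the linear term of [shift 1]. *)
Lemma is_derive_shift (n : nat) (nu a : R) (b : nat -> R) (k : nat) (x : R) :
  (4 <= n)%nat -> nu ^ 2 = 1 -> (k < n)%nat ->
  is_derive (shift n nu a b k) x
    (rate nu a k (b (S k) + shift n nu a b (S k) x) x).
Proof.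
  intros Hn Hnu Hk.
  pose proof (is_derive_shift_sum n nu a b k x Hk) as D.
  destruct k as [|[|[|k]]]; simpl shift; unfold rate.
  - match goal with |- is_derive _ _ ?l => replace l with
      (plus (- nu * (INR 0 + 1) * a * (b 1%nat + shift_sum n nu a b 1 x))
         (a ^ 2 * (1 + b 2%nat * (1 - nu)) * nu * (2 * x)))
      by (unfold plus; simpl; ring) end.
    apply (is_derive_plus (V := R_NormedModule)); [exact D|].
    auto_derive; [exact I|ring].
  - match goal with |- is_derive _ _ ?l => replace l with
      (minus (- nu * (INR 1 + 1) * a * (b 2%nat + shift_sum n nu a b 2 x))
         (a * (2 * b 2%nat * (1 - nu) + 1)))
      by (unfold minus, plus, opp; simpl; ring) end.
    apply (is_derive_minus (V := R_NormedModule)); [exact D|].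
    auto_derive; [exact I|ring].
  - match goal with |- is_derive _ _ ?l => replace l with
      (nu * (- nu * (INR 2 + 1) * a * (b 3%nat + shift_sum n nu a b 3 x))) end.
    + apply is_derive_scal; exact D.
    + transitivity (- nu ^ 2 * 3 * a * (b 3%nat + shift_sum n nu a b 3 x)).
      * simpl; ring.
      * rewrite Hnu; ring.
  - exact D.
Qed.

Lemma shift_n (n : nat) (nu a : R) (b : nat -> R) (x : R) :
  (3 <= n)%nat -> shift n nu a b n x = 0.
Proof.
  intros Hn; destruct n as [|[|[|n]]]; try lia. apply shift_sum_n.
Qed.

(** Only constants of index above [k] enter, so in a descending induction choosing [b m] leaves the
    shifts of index at least [m] unchanged. *)
Lemma shift_ext (n : nat) (nu a : R) (b c : nat -> R) (k : nat) (x : R) :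
  (forall j : nat, (k < j)%nat -> b j = c j) ->
  shift n nu a b k x = shift n nu a c k x.
Proof.
  intros E.
  assert (Es : shift_sum n nu a b k x = shift_sum n nu a c k x).
  { apply sum_n_m_ext_loc; intros i Hi; rewrite E by lia; reflexivity. }
  destruct k as [|[|[|k]]]; simpl; rewrite Es, ?(E 2%nat) by lia; reflexivity.
Qed.

(** * Calculus on an open interval *)

Lemma locally_open_interval (U : R -> Prop) (u : R) :
  is_open_interval U -> U u -> locally u U.
Proof.
  intros (l & r & HU) Hu.
  apply (filter_imp (fun x : R => Rbar_lt l x /\ Rbar_lt x r)).
  - intros x; apply HU.
  - apply HU in Hu; apply filter_and.
    + now apply (open_Rbar_gt l u).
    + now apply (open_Rbar_lt r u).
Qed.

(** The segment between two points of [U] stays in [U]; here it matters that [U] is an interval and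
    not merely open. *)
Lemma is_derive_zero_const (U : R -> Prop) (h : R -> R) :
  is_open_interval U -> (forall u, U u -> is_derive h u 0) ->
  forall u v, U u -> U v -> h u = h v.
Proof.
  intros (l & r & HU) D.
  assert (L : forall u v, U u -> U v -> u < v -> h u = h v).
  { intros u v Hu Hv Huv; apply (eq_is_derive (V := R_NormedModule)); [|exact Huv].
    intros t [H1 H2]; apply D, HU; apply HU in Hu; apply HU in Hv; split.
    - apply Rbar_lt_le_trans with u; [apply Hu|exact H1].
    - apply Rbar_le_lt_trans with v; [exact H2|apply Hv]. }
  intros u v Hu Hv; destruct (Rtotal_order u v) as [H|[H|H]].
  - now apply L.
  - now subst.
  - symmetry; now apply L.
Qed.

(** * Solving the hierarchy [h_k' = r_k (h_(k+1), T) T'] *)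

Lemma is_derive_shift_comp (n : nat) (nu a : R) (b : nat -> R) (k : nat)
    (T : R -> R) (u dT : R) :
  (4 <= n)%nat -> nu ^ 2 = 1 -> (k < n)%nat -> is_derive T u dT ->
  is_derive (fun v => shift n nu a b k (T v)) u
    (rate nu a k (b (S k) + shift n nu a b (S k) (T u)) (T u) * dT).
Proof.
  intros Hn Hnu Hk HT; rewrite Rmult_comm.
  apply (is_derive_comp (V := R_NormedModule)); [|exact HT].
  now apply is_derive_shift.
Qed.

(** Once [h (S m)] has the claimed form, [h m] and [shift m] along [T] have the same derivative, and
    their constant difference is [b m]. The converse is the chain rule. *)
Lemma hierarchy_solution (n : nat) (U : R -> Prop) (nu a bn : R)
    (h : nat -> R -> R) (T dT : R -> R) :
  (4 <= n)%nat -> is_open_interval U -> nu ^ 2 = 1 ->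
  (forall u, U u -> is_derive T u (dT u)) ->
  (forall u, U u -> h n u = bn) ->
  (forall k, (k < n)%nat -> forall u, U u ->
     is_derive (h k) u (rate nu a k (h (S k) u) (T u) * dT u)) <->
  (exists b : nat -> R, b n = bn /\
     forall k, (k <= n)%nat -> forall u, U u ->
       h k u = b k + shift n nu a b k (T u)).
Proof.
  intros Hn HU Hnu HT Hhn; split.
  - intros D.
    (* Here [j] counts the indices below [n] already solved; values of [b] below [n - j] are still
       arbitrary. *)
    assert (Hj : forall j, (j <= n)%nat -> exists b : nat -> R, b n = bn /\
      forall k, (n - j <= k <= n)%nat -> forall u, U u ->
       h k u = b k + shift n nu a b k (T u)).
    2: { destruct (Hj n (le_n n)) as (b & Hb & Hs); exists b; split; [exact Hb|].
         intros k Hk; apply Hs; lia. }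
    induction j as [|j IH]; intros Hjn.
    + exists (fun _ => bn); split; [reflexivity|].
      intros k Hk u Hu; replace k with n by lia.
      rewrite shift_n, Hhn by (lia || assumption); ring.
    + destruct IH as (b & Hb & Hs); [lia|].
      set (m := (n - S j)%nat).
      assert (Hc : forall u v, U u -> U v ->
        h m u - shift n nu a b m (T u) = h m v - shift n nu a b m (T v)).
      { apply (is_derive_zero_const U
          (fun u => h m u - shift n nu a b m (T u)) HU).
        intros u Hu.
        match goal with |- is_derive _ _ ?z => replace z with (minus
          (rate nu a m (h (S m) u) (T u) * dT u)
          (rate nu a m (b (S m) + shift n nu a b (S m) (T u)) (T u) * dT u)) end.
        - apply (is_derive_minus (V := R_NormedModule)).
          + apply D; [lia|exact Hu].
          + apply is_derive_shift_comp; [assumption..|lia|now apply HT].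
        - rewrite (Hs (S m)) by (lia || assumption).
          unfold minus, plus, opp; simpl; ring. }
      assert (Hconst : exists c, forall u, U u ->
        h m u = c + shift n nu a b m (T u)).
      (* The constant is read off at any point of [U]. The interval may be empty, and then any value
         serves. *)
      { destruct (Classical_Prop.classic (exists v, U v)) as [[v Hv]|Hno].
        - exists (h m v - shift n nu a b m (T v)); intros u Hu.
          rewrite <- (Hc u v Hu Hv); ring.
        - exists 0; intros u Hu; exfalso; eauto. }
      destruct Hconst as [c Hcst].
      exists (fun k => if Nat.eqb k m then c else b k); split.
      * replace (Nat.eqb n m) with false; [exact Hb|].
        symmetry; apply Nat.eqb_neq; lia.
      * intros k Hk u Hu.
        (* Since [m <= k], the shift of index [k] does not see the new value at [m]. *)
        rewrite (shift_ext n nu a _ b).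
        2: { intros i Hi; replace (Nat.eqb i m) with false; [reflexivity|].
             symmetry; apply Nat.eqb_neq; lia. }
        destruct (Nat.eqb_spec k m) as [->|Hne]; [now apply Hcst|].
        apply Hs; [lia|exact Hu].
  - intros (b & Hb & Hs) k Hk u Hu.
    rewrite Hs by (lia || assumption).
    pose proof (locally_open_interval U u HU Hu) as Hloc.
    apply is_derive_ext_loc with (f := fun v => b k + shift n nu a b k (T v)).
    { apply (filter_imp U); [|exact Hloc]; intros v Hv; symmetry; apply Hs; [lia|exact Hv]. }
    match goal with |- is_derive _ _ ?z => rewrite <- (Rplus_0_l z) end.
    apply (is_derive_plus (V := R_NormedModule)).
    + apply (is_derive_const (V := R_NormedModule)).
    + now apply is_derive_shift_comp; auto.
Qed.

(** * The substitution, and each identity of the system rewritten by it *)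

(* For [s = ln T] this is [T^(2-k) y^(k-1)]. *)
Definition weight (k : nat) (s y : R) : R :=
  exp ((INR k - 1) * ln y - (INR k - 2) * s).

(** These are the [h_k]; the parameter [S] is [ln T] and shadows the successor, later written
    [Datatypes.S]. Subtracting [Derive g] at index 2 absorbs [- g''] in the third identity and
    [- 2 a g'] in the second. *)
Definition normalized (nu : R) (f : nat -> R -> R) (S g : R -> R)
    (k : nat) (u : R) : R :=
  match k with
  | 2%nat => f 2%nat u * g u - Derive g u
  | _ => f k u * weight k (S u) (nu * g u)
  end.

(** Passing from [k] to [k + 1] multiplies the weight by [y / T]. This is what turns a coupling to
    [f_(k+1)] into one to [h_(k+1)]. *)
Lemma weight_S (k : nat) (s y : R) :
  0 < y -> weight (S k) s y * exp s = weight k s y * y.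
Proof.
  intros Hy; unfold weight.
  rewrite <- (exp_ln y Hy) at 3; rewrite <- !exp_plus, S_INR; f_equal; ring.
Qed.

Lemma weight_pos (k : nat) (s y : R) : 0 < weight k s y.
Proof. apply exp_pos. Qed.

Lemma weight_2 (s y : R) : 0 < y -> weight 2 s y = y.
Proof.
  intros Hy; unfold weight; rewrite <- (exp_ln y Hy) at 2; f_equal; simpl; ring.
Qed.

(** As [S' = 1 / g], the logarithmic derivative of the weight is [((k - 1) g' + (2 - k)) / g]. The
    bracket is therefore the part without [a] of the identities for [k <> 2]. *)
Lemma is_derive_weighted (nu : R) (k : nat) (f S g : R -> R) (u : R) :
  0 < nu * g u -> ex_derive f u -> ex_derive g u -> is_derive S u (/ g u) ->
  is_derive (fun v => f v * weight k (S v) (nu * g v)) u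
    (weight k (S u) (nu * g u) / g u
     * (Derive f u * g u + (INR k - 1) * f u * Derive g u + (2 - INR k) * f u)).
Proof.
  intros Hg Df Dg DS; unfold weight.
  assert (Hg0 : g u <> 0) by (intros E; rewrite E in Hg; lra).
  assert (Hnu : nu <> 0) by (intros E; rewrite E in Hg; lra).
  assert (DS' : ex_derive S u) by now exists (/ g u).
  auto_derive; [tauto|].
  change (Derive (fun x => S x) u) with (Derive S u).
  change (Derive (fun x => f x) u) with (Derive f u).
  change (Derive (fun x => g x) u) with (Derive g u).
  rewrite (is_derive_unique S u _ DS).
  unfold Rminus; field; tauto.
Qed.

Lemma is_derive_iff (h : R -> R) (u d e : R) :
  is_derive h u d -> (is_derive h u e <-> d = e).
Proof.
  intros D; split; intros H; [|now subst].
  rewrite <- (is_derive_unique h u d D); now apply is_derive_unique.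
Qed.

(** Reduces an equivalence of two equations to one algebraic identity between their defects, once a
    nonzero factor [c] is named. *)
Lemma scaled_eq_iff (c x y d e : R) :
  c <> 0 -> d - e = c * (x - y) -> (x = y <-> d = e).
Proof.
  intros Hc H; split; intros E.
  - apply Rminus_diag_uniq; rewrite H, E; ring.
  - apply Rminus_diag_uniq. apply (Rmult_eq_reg_l c); [|exact Hc].
    rewrite <- H, E; ring.
Qed.

(** Multiplying the identity by [weight / g] gives the equation for [h_k']. *)
Lemma equation_ge3 (nu a : R) (f : nat -> R -> R) (S g : R -> R) (k : nat) (u : R) :
  nu ^ 2 = 1 -> 0 < nu * g u -> (3 <= k)%nat ->
  ex_derive (f k) u -> ex_derive g u -> is_derive S u (/ g u) ->
  Derive (f k) u * g u + (INR k + 1) * a * f (Datatypes.S k) u * g u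
    + (INR k - 1) * f k u * Derive g u + (2 - INR k) * f k u = 0 <->
  is_derive (normalized nu f S g k) u
    (rate nu a k (normalized nu f S g (Datatypes.S k) u) (exp (S u))
     * (exp (S u) / g u)).
Proof.
  intros Hnu Hg Hk Df Dg DS.
  assert (Hg0 : g u <> 0) by (intros E; rewrite E in Hg; lra).
  pose proof (weight_pos k (S u) (nu * g u)) as Hw.
  pose proof (weight_S k (S u) (nu * g u) Hg) as Hw1.
  pose proof (is_derive_weighted nu k (f k) S g u Hg Df Dg DS) as D.
  destruct k as [|[|[|k]]]; try lia.
  rewrite (is_derive_iff _ _ _ _ D); unfold rate, normalized.
  set (K := Datatypes.S (Datatypes.S (Datatypes.S k))) in *.
  apply scaled_eq_iff with (c := weight K (S u) (nu * g u) / g u).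
  - apply Rmult_integral_contrapositive; split; [lra|now apply Rinv_neq_0_compat].
  (* The coupling is grouped as [weight * exp] so that [weight_S] applies. It then yields a second
     factor [nu], and [nu ^ 2 = 1] finishes. *)
  - transitivity (weight K (S u) (nu * g u) / g u *
     (Derive (f K) u * g u + (INR K - 1) * f K u * Derive g u + (2 - INR K) * f K u)
     + nu * (INR K + 1) * a * f (Datatypes.S K) u / g u
       * (weight (Datatypes.S K) (S u) (nu * g u) * exp (S u))).
    + field; exact Hg0.
    + rewrite Hw1.
      transitivity (weight K (S u) (nu * g u) / g u *
       (Derive (f K) u * g u + (INR K - 1) * f K u * Derive g u + (2 - INR K) * f K u)
       + nu ^ 2 * (INR K + 1) * a * f (Datatypes.S K) u * weight K (S u) (nu * g u)).
      * field; exact Hg0.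
      * rewrite Hnu; field; exact Hg0.
Qed.

Lemma weight_3 (s y : R) : 0 < y -> weight 3 s y = y ^ 2 / exp s.
Proof.
  intros Hy; pose proof (exp_pos s); pose proof (weight_S 2 s y Hy) as H2.
  rewrite weight_2 in H2 by exact Hy.
  apply (Rmult_eq_reg_r (exp s)); [rewrite H2; field|]; lra.
Qed.

Lemma weight_1 (s y : R) : weight 1 s y = exp s.
Proof. unfold weight; f_equal; simpl; ring. Qed.

Lemma weight_0 (s y : R) : 0 < y -> weight 0 s y = exp s ^ 2 / y.
Proof.
  intros Hy; pose proof (weight_S 0 s y Hy) as H1; rewrite weight_1 in H1.
  apply (Rmult_eq_reg_r y); [rewrite <- H1; field|]; lra.
Qed.

(** The derivative of [f_2 g - g'] is already the part without [a], so the factor is 1. In the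
    coupling, [h_3 T / g] equals [f_3 g] because [(nu g) ^ 2 = g ^ 2]. *)
Lemma equation_2 (nu a : R) (f : nat -> R -> R) (S g : R -> R) (u : R) :
  nu ^ 2 = 1 -> 0 < nu * g u ->
  ex_derive (f 2%nat) u -> ex_derive g u -> ex_derive (Derive g) u ->
  - Derive_n g 2 u + Derive (f 2%nat) u * g u + 3 * a * f 3%nat u * g u
    + f 2%nat u * Derive g u = 0 <->
  is_derive (normalized nu f S g 2) u
    (rate nu a 2 (normalized nu f S g 3 u) (exp (S u)) * (exp (S u) / g u)).
Proof.
  intros Hnu Hg Df Dg Dg2.
  assert (Hg0 : g u <> 0) by (intros E; rewrite E in Hg; lra).
  assert (D : is_derive (normalized nu f S g 2) u
    (Derive (f 2%nat) u * g u + f 2%nat u * Derive g u - Derive_n g 2 u)).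
  { unfold normalized; auto_derive; [tauto|].
    change (Derive (fun x => f 2%nat x) u) with (Derive (f 2%nat) u).
    change (Derive (fun x => g x) u) with (Derive g u).
    change (Derive_n g 2 u) with (Derive (fun x => Derive g x) u).
    ring. }
  rewrite (is_derive_iff _ _ _ _ D); unfold rate, normalized.
  rewrite weight_3 by exact Hg.
  pose proof (exp_pos (S u)).
  apply scaled_eq_iff with (c := 1); [lra|].
  transitivity (Derive (f 2%nat) u * g u + f 2%nat u * Derive g u - Derive_n g 2 u
    + 3 * a * f 3%nat u * g u * nu ^ 2).
  - field; lra.
  - rewrite Hnu; ring.
Qed.

(** From [f_2 g = h_2 + g'], the terms with [a] collapse to [a (1 + 2 h_2)]. *)
Lemma equation_1 (nu a : R) (f : nat -> R -> R) (S g : R -> R) (u : R) :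
  0 < nu * g u ->
  ex_derive (f 1%nat) u -> ex_derive g u -> is_derive S u (/ g u) ->
  a * (1 - 2 * Derive g u) + Derive (f 1%nat) u * g u
    + 2 * a * f 2%nat u * g u + f 1%nat u = 0 <->
  is_derive (normalized nu f S g 1) u
    (rate nu a 1 (normalized nu f S g 2 u) (exp (S u)) * (exp (S u) / g u)).
Proof.
  intros Hg Df Dg DS.
  assert (Hg0 : g u <> 0) by (intros E; rewrite E in Hg; lra).
  pose proof (is_derive_weighted nu 1 (f 1%nat) S g u Hg Df Dg DS) as D.
  rewrite (is_derive_iff _ _ _ _ D); unfold rate, normalized.
  rewrite weight_1; pose proof (exp_pos (S u)).
  apply scaled_eq_iff with (c := exp (S u) / g u).
  - apply Rmult_integral_contrapositive; split; [lra|now apply Rinv_neq_0_compat].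
  - simpl INR; field; exact Hg0.
Qed.

Lemma equation_0 (nu a : R) (f : nat -> R -> R) (S g : R -> R) (u : R) :
  nu ^ 2 = 1 -> 0 < nu * g u ->
  ex_derive (f 0%nat) u -> ex_derive g u -> is_derive S u (/ g u) ->
  - a ^ 2 * g u + Derive (f 0%nat) u * g u + a * f 1%nat u * g u
    - f 0%nat u * Derive g u + 2 * f 0%nat u = 0 <->
  is_derive (normalized nu f S g 0) u
    (rate nu a 0 (normalized nu f S g 1 u) (exp (S u)) * (exp (S u) / g u)).
Proof.
  intros Hnu Hg Df Dg DS.
  assert (Hg0 : g u <> 0) by (intros E; rewrite E in Hg; lra).
  assert (Hnu0 : nu <> 0) by (intros E; rewrite E in Hg; lra).
  pose proof (is_derive_weighted nu 0 (f 0%nat) S g u Hg Df Dg DS) as D.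
  rewrite (is_derive_iff _ _ _ _ D); unfold rate, normalized.
  rewrite weight_1, weight_0 by exact Hg; pose proof (exp_pos (S u)).
  (* The leading [nu] of [rate] becomes [/ nu], matching the weight [T ^ 2 / (nu g)]; the identity
     then holds for every nonzero [nu]. *)
  replace nu with (/ nu) at 2.
  2: { apply (Rmult_eq_reg_l nu); [|exact Hnu0].
       rewrite Rinv_r by exact Hnu0; rewrite <- Hnu; ring. }
  apply scaled_eq_iff with (c := exp (S u) ^ 2 / (nu * g u) / g u).
  - repeat apply Rmult_integral_contrapositive_currified;
      try apply Rinv_neq_0_compat; lra.
  - simpl INR; field; tauto.
Qed.

Lemma system_iff_hierarchy (n : nat) (U : R -> Prop) (nu a : R)
    (f : nat -> R -> R) (S g : R -> R) :
  (4 <= n)%nat -> nu ^ 2 = 1 ->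
  (forall k, (k <= n)%nat -> forall u, U u -> ex_derive (f k) u) ->
  (forall u, U u -> 0 < nu * g u) ->
  (forall u, U u -> ex_derive g u) ->
  (forall u, U u -> ex_derive (Derive g) u) ->
  (forall u, U u -> is_derive S u (/ g u)) ->
  satisfies_system n U a f g <->
  (forall k, (k < n)%nat -> forall u, U u ->
    is_derive (normalized nu f S g k) u
      (rate nu a k (normalized nu f S g (Datatypes.S k) u) (exp (S u))
       * (exp (S u) / g u))).
Proof.
  intros Hn Hnu Df Hg Dg Dg2 DS; split.
  - intros H k Hk u Hu; destruct (H u Hu) as (H0 & H1 & H2 & H3).
    destruct k as [|[|[|k]]].
    + apply equation_0; auto with arith.
    + apply equation_1; auto. apply Df; [lia|exact Hu].
    + apply equation_2; auto. apply Df; [lia|exact Hu].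
    + apply equation_ge3; auto with arith. apply H3; lia.
  - intros H u Hu; repeat split; [| | |intros k Hk].
    + apply (equation_0 nu a f S g u); auto with arith. apply H; [lia|exact Hu].
    + apply (equation_1 nu a f S g u); auto; [apply Df|apply H]; auto; lia.
    + apply (equation_2 nu a f S g u); auto; [apply Df|apply H]; auto; lia.
    + apply (equation_ge3 nu a f S g k u); auto; try lia; [apply Df|apply H]; auto; lia.
Qed.

(** * Matching [coefficient_functions] with the polynomials [shift] *)

Lemma Rpower_nat_mul (x y : R) (i : nat) : Rpower x (INR i * y) = Rpower x y ^ i.
Proof.
  rewrite Rmult_comm, <- Rpower_mult, Rpower_pow; [reflexivity|apply exp_pos].
Qed.

Lemma coefficient_functions_shift (n : nat) (U : R -> Prop) (a eps nu : R)
    (F : R -> R) (b : nat -> R) (A B : nat -> R -> R) :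
  (4 <= n)%nat -> coefficient_functions n U a eps nu F b A B ->
  forall u, U u -> forall k, (k <= n)%nat ->
    B k u = shift n nu a b k (Rpower (Rabs (F u)) ((INR n - 1) / (INR n - 2))).
Proof.
  intros Hn [_ H] u Hu k Hk.
  destruct (H u Hu) as (An & Ak & B3 & B2 & B1 & B0).
  set (T := Rpower (Rabs (F u)) ((INR n - 1) / (INR n - 2))) in *.
  assert (E : forall j, (j <= n)%nat -> A j u = shift_sum n nu a b j T).
  { intros j Hj; destruct (Nat.eq_dec j n) as [->|Hjn].
    - now rewrite An, shift_sum_n.
    - rewrite Ak by lia; apply sum_n_m_ext; intros i.
      unfold T; replace (INR i * (INR n - 1) / (INR n - 2))
        with (INR i * ((INR n - 1) / (INR n - 2))) by (unfold Rdiv; ring).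
      now rewrite Rpower_nat_mul. }
  replace (Rpower (Rabs (F u)) (2 * (INR n - 1) / (INR n - 2))) with (T ^ 2) in B0.
  2: { unfold T; rewrite <- Rpower_nat_mul; f_equal; simpl; unfold Rdiv; ring. }
  destruct k as [|[|[|k]]]; simpl shift.
  - rewrite B0, E by lia; ring.
  - rewrite B1, E by lia; ring.
  - rewrite B2, E by lia; ring.
  - rewrite B3, E by lia; reflexivity.
Qed.

(** Supplies the witnesses [A] and [B] when the constants [b] are given. [T] is a parameter so that
    it can be instantiated by an exponential convertible to the [Rpower]. *)
Lemma shift_coefficient_functions (n : nat) (U : R -> Prop) (a eps nu : R)
    (F : R -> R) (b : nat -> R) (T : R -> R) :
  (4 <= n)%nat ->
  b n = eps * powerRZ ((INR n - 1) / (INR n - 2)) (1 - Z.of_nat n) ->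
  (forall u, T u = Rpower (Rabs (F u)) ((INR n - 1) / (INR n - 2))) ->
  coefficient_functions n U a eps nu F b
    (fun k u => shift_sum n nu a b k (T u)) (fun k u => shift n nu a b k (T u)).
Proof.
  intros Hn Hb HT; split; [exact Hb|]; intros u _; repeat split.
  - apply shift_sum_n.
  - intros k Hk; apply sum_n_m_ext; intros i.
    rewrite HT; replace (INR i * (INR n - 1) / (INR n - 2))
        with (INR i * ((INR n - 1) / (INR n - 2))) by (unfold Rdiv; ring).
      now rewrite Rpower_nat_mul.
  - intros k Hk; destruct k as [|[|[|k]]]; try lia; reflexivity.
  - simpl shift; rewrite HT; ring.
  - simpl shift.
    replace (Rpower (Rabs (F u)) (2 * (INR n - 1) / (INR n - 2))) with (T u ^ 2).
    + reflexivity.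
    + rewrite HT, <- Rpower_nat_mul; f_equal; simpl; unfold Rdiv; ring.
Qed.

(** The factor of [f_k] in the closed form is the inverse of the weight, as [x / (c p)] is [nu g]
    for [x = |F|] and [p = F']. All bases are positive, so after taking logarithms the coefficients
    of [ln c], [ln x] and [ln p] each vanish. *)
Lemma closed_form_weight (n k : nat) (x p : R) :
  (4 <= n)%nat -> 0 < x -> 0 < p ->
  let c := (INR n - 1) / (INR n - 2) in
  powerRZ c (Z.of_nat k - 1) * Rpower x ((INR k - INR n) / (INR n - 2))
    * powerRZ p (Z.of_nat k - 1) * weight k (c * ln x) (x / (c * p)) = 1.
Proof.
  intros Hn Hx Hp c.
  assert (HN : 4 <= INR n) by (apply (le_INR 4) in Hn; simpl in Hn; lra).
  assert (Hc : 0 < c) by (apply Rdiv_lt_0_compat; lra).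
  rewrite !powerRZ_Rpower by assumption.
  rewrite minus_IZR, <- INR_IZR_INZ; unfold Rpower, weight.
  rewrite ln_div, ln_mult by (assumption || now apply Rmult_lt_0_compat).
  rewrite <- !exp_plus; transitivity (exp 0); [f_equal|apply exp_0].
  generalize (ln c); intros lc; unfold c; field; lra.
Qed.

(** * Derivatives of [g] and of [ln T] *)

Lemma is_derive_quotient (U : R -> Prop) (F g : R -> R) (c : R) :
  is_open_interval U -> c <> 0 -> times_differentiable_on 3 U F ->
  (forall u, U u -> Derive F u <> 0) ->
  (forall u, U u -> g u = F u / (c * Derive F u)) ->
  forall u, U u ->
    is_derive g u ((1 - F u * Derive_n F 2 u / Derive F u ^ 2) / c).
Proof.
  intros HU Hc HF HF' Hg u Hu.
  apply is_derive_ext_loc with (f := fun v => F v / (c * Derive F v)).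
  { apply (filter_imp U); [|now apply locally_open_interval].
    intros v Hv; symmetry; now apply Hg. }
  assert (D1 : ex_derive F u) by (apply (HF u Hu 1%nat); auto with arith).
  assert (D2 : ex_derive (Derive F) u) by (apply (HF u Hu 2%nat); auto with arith).
  assert (HFu := HF' u Hu).
  auto_derive.
  - repeat split; auto.
  - change (Derive_n F 2 u) with (Derive (fun x => Derive F x) u).
    change (Derive (fun x => F x) u) with (Derive F u).
    change (Derive (fun x => Derive (fun x0 => F x0) x) u)
      with (Derive (fun x => Derive F x) u).
    change (fun x => F x) with F.
    field; tauto.
Qed.

(** The explicit formula for [g'] contains [F''], so differentiating it calls on the third
    derivative of [F]. *)
Lemma ex_derive_2_quotient (U : R -> Prop) (F g : R -> R) (c : R) :
  is_open_interval U -> c <> 0 -> times_differentiable_on 3 U F ->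
  (forall u, U u -> Derive F u <> 0) ->
  (forall u, U u -> g u = F u / (c * Derive F u)) ->
  forall u, U u -> ex_derive (Derive g) u.
Proof.
  intros HU Hc HF HF' Hg u Hu.
  apply ex_derive_ext_loc
    with (f := fun v => (1 - F v * Derive_n F 2 v / Derive F v ^ 2) / c).
  { apply (filter_imp U); [|now apply locally_open_interval].
    intros v Hv; symmetry; apply is_derive_unique.
    now apply (is_derive_quotient U). }
  assert (D1 : ex_derive F u) by (apply (HF u Hu 1%nat); auto with arith).
  assert (D2 : ex_derive (Derive F) u) by (apply (HF u Hu 2%nat); auto with arith).
  assert (D3 : ex_derive (Derive_n F 2) u) by (apply (HF u Hu 3%nat); auto with arith).
  assert (HFu := HF' u Hu).
  auto_derive; repeat split; auto.
Qed.

(** On [U] the absolute value is the linear expression [nu * F]. The resulting derivative is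
    [1 / g], as the substitution requires of [ln T]. *)
Lemma is_derive_ln_Rabs (U : R -> Prop) (F : R -> R) (nu c u : R) :
  is_open_interval U -> (forall v, U v -> Rabs (F v) = nu * F v) ->
  U u -> F u <> 0 -> ex_derive F u ->
  is_derive (fun v => c * ln (Rabs (F v))) u (c * Derive F u / F u).
Proof.
  intros HU Hnu Hu HF DF.
  pose proof (Rabs_pos_lt _ HF) as Hpos; rewrite Hnu in Hpos by exact Hu.
  apply is_derive_ext_loc with (f := fun v => c * ln (nu * F v)).
  { apply (filter_imp U); [|now apply locally_open_interval].
    intros v Hv; now rewrite Hnu. }
  auto_derive; [tauto|].
  change (Derive (fun x => F x) u) with (Derive F u).
  field; split; [exact HF|]; intros E; rewrite E in Hpos; lra.
Qed.

(** * The closed forms in terms of the [h_k], and the leading coefficient *)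

(** For [k <> 2] multiply the formula by the weight, which cancels its factor. For [k = 2] multiply
    by [g]: then [c F' / F] becomes 1, and [F' / F - F'' / F'] becomes [g']. *)
Lemma general_solution_normalized (n : nat) (U : R -> Prop) (f : nat -> R -> R)
    (F g : R -> R) (nu : R) (b : nat -> R) (B : nat -> R -> R) :
  (4 <= n)%nat ->
  (forall u, U u -> F u <> 0) -> (forall u, U u -> 0 < Derive F u) ->
  (forall u, U u -> Rabs (F u) = nu * F u) ->
  (forall u, U u -> g u = F u / ((INR n - 1) / (INR n - 2) * Derive F u)) ->
  (forall u, U u -> Derive g u =
     (1 - F u * Derive_n F 2 u / Derive F u ^ 2) / ((INR n - 1) / (INR n - 2))) ->
  general_solution n U f F b B <->
  (forall k, (k <= n)%nat -> forall u, U u ->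
     normalized nu f (fun v => (INR n - 1) / (INR n - 2) * ln (Rabs (F v))) g k u
       = b k + B k u).
Proof.
  intros Hn HF HF' Hnu Hg Hg'.
  assert (HN : 4 <= INR n) by (apply (le_INR 4) in Hn; simpl in Hn; lra).
  pose proof (fun k x p => closed_form_weight n k x p Hn) as W; cbv zeta in W.
  set (c := (INR n - 1) / (INR n - 2)) in *.
  assert (Hc : 0 < c) by (apply Rdiv_lt_0_compat; lra).
  assert (E2 : forall u, U u ->
    (f 2%nat u = (b 2%nat + B 2%nat u) * c * (Derive F u / F u)
       + Derive F u / F u - Derive_n F 2 u / Derive F u <->
     f 2%nat u * g u - Derive g u = b 2%nat + B 2%nat u)).
  { intros u Hu; specialize (HF u Hu); specialize (HF' u Hu).
    apply scaled_eq_iff with (c := g u).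
    - rewrite Hg by exact Hu; apply Rmult_integral_contrapositive_currified;
        [exact HF|apply Rinv_neq_0_compat].
      apply Rmult_integral_contrapositive_currified; lra.
    - rewrite Hg, Hg' by exact Hu; field; repeat split; lra. }
  assert (Ek : forall k u, U u ->
    (f k u = (b k + B k u) * powerRZ c (Z.of_nat k - 1)
       * Rpower (Rabs (F u)) ((INR k - INR n) / (INR n - 2))
       * powerRZ (Derive F u) (Z.of_nat k - 1) <->
     f k u * weight k (c * ln (Rabs (F u))) (nu * g u) = b k + B k u)).
  { intros k u Hu.
    apply scaled_eq_iff with (c := weight k (c * ln (Rabs (F u))) (nu * g u)).
    - apply Rgt_not_eq, weight_pos.
    - specialize (W k (Rabs (F u)) (Derive F u) (Rabs_pos_lt _ (HF u Hu)) (HF' u Hu)).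
      replace (Rabs (F u) / (c * Derive F u)) with (nu * g u) in W.
      2: { rewrite Hg, Hnu by exact Hu; unfold Rdiv; ring. }
      match goal with |- _ - ?e = _ => transitivity
        (f k u * weight k (c * ln (Rabs (F u))) (nu * g u) - e * 1); [ring|] end.
      rewrite <- W; ring. }
  split.
  - intros H k Hk u Hu; destruct (H u Hu) as [H1 H2].
    destruct k as [|[|[|k]]]; unfold normalized.
    3: exact (proj1 (E2 u Hu) H2).
    1-3: apply (Ek _ u Hu); apply H1; [exact Hk|discriminate].
  - intros H u Hu; split.
    + intros k Hk Hk2; specialize (H k Hk u Hu); apply (Ek _ u Hu).
      destruct k as [|[|[|k]]]; unfold normalized in H; [exact H..|tauto|exact H].
    + apply (E2 u Hu). apply (H 2%nat); [lia|exact Hu].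
Qed.

(** This explains the value of [b_n]: the powers of [c] cancel, the exponent of [x] is 0, and
    [p ^ (n - 1) = |f_n|], whence [eps * |f_n| = f_n]. *)
Lemma leading_closed_form (n : nat) (fn p x eps : R) :
  (4 <= n)%nat -> fn <> 0 -> p = Rpower (Rabs fn) (1 / (INR n - 1)) ->
  Rabs fn = eps * fn -> eps = 1 \/ eps = -1 ->
  let c := (INR n - 1) / (INR n - 2) in
  fn = eps * powerRZ c (1 - Z.of_nat n) * powerRZ c (Z.of_nat n - 1)
       * Rpower x ((INR n - INR n) / (INR n - 2)) * powerRZ p (Z.of_nat n - 1).
Proof.
  intros Hn Hfn Hp Habs Heps c.
  assert (HN : 4 <= INR n) by (apply (le_INR 4) in Hn; simpl in Hn; lra).
  assert (Hc : 0 < c) by (apply Rdiv_lt_0_compat; lra).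
  assert (Hp0 : 0 < p) by (rewrite Hp; apply exp_pos).
  rewrite (Rmult_assoc eps), <- (powerRZ_add c) by lra.
  replace (1 - Z.of_nat n + (Z.of_nat n - 1))%Z with 0%Z by lia.
  rewrite (powerRZ_Rpower p) by exact Hp0.
  rewrite minus_IZR, <- INR_IZR_INZ, Hp, Rpower_mult.
  replace (1 / (INR n - 1) * (INR n - 1)) with 1 by (field; lra).
  rewrite Rpower_1 by now apply Rabs_pos_lt.
  unfold Rdiv; rewrite Rminus_diag, Rmult_0_l; unfold Rpower.
  rewrite Rmult_0_l, exp_0, Habs; simpl.
  destruct Heps as [-> | ->]; ring.
Qed.

Lemma shift_a0 (n : nat) (nu : R) (b : nat -> R) (k : nat) (x : R) :
  shift n nu 0 b k x = 0.
Proof.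
  assert (E : forall j, shift_sum n nu 0 b j x = 0).
  { intros j; unfold shift_sum.
    transitivity (sum_n_m (fun _ : nat => (zero : R)) 1 (n - j)).
    - apply sum_n_m_ext_loc; intros i [Hi _].
      (* The sum starts at [i = 1], so [0 ^ 0] never occurs. *)
      rewrite (pow_i i) by lia.
      unfold zero; simpl; ring.
    - apply (sum_n_m_const_zero (G := R_AbelianMonoid)). }
  destruct k as [|[|[|k]]]; simpl shift; rewrite E; ring.
Qed.

(** * Assembling the equivalence and its cases [a = 0] and [F > 0] *)

Theorem theorem3
  (n : nat) (hn : (4 <= n)%nat)
  (U : R -> Prop) (hU : is_open_interval U)
  (f : nat -> R -> R)
  (hf : forall k : nat, (k <= n)%nat -> forall u : R, U u -> ex_derive (f k) u)
  (F : R -> R) (hF : times_differentiable_on 3 U F)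
  (hfn0 : forall u : R, U u -> f n u <> 0)
  (hF0 : forall u : R, U u -> F u <> 0)
  (hF' : forall u : R, U u -> Derive F u = Rpower (Rabs (f n u)) (1 / (INR n - 1)))
  (g : R -> R)
  (hg : forall u : R, U u -> g u = ((INR n - 2) * F u) / ((INR n - 1) * Derive F u))
  (eps nu a : R)
  (heps : eps = 1 \/ eps = -1) (hnu : nu = 1 \/ nu = -1)
  (hepsf : forall u : R, U u -> Rabs (f n u) = eps * f n u)
  (hnuF : forall u : R, U u -> Rabs (F u) = nu * F u) :
  (satisfies_system n U a f g <->
     exists (b : nat -> R) (A B : nat -> R -> R),
       coefficient_functions n U a eps nu F b A B
       /\ general_solution n U f F b B)
  /\ (a = 0 ->
       (forall (b : nat -> R) (A B : nat -> R -> R),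
          coefficient_functions n U a eps nu F b A B ->
          forall u : R, U u -> forall k : nat, (k <= n)%nat -> B k u = 0)
       /\ (satisfies_system n U a f g <->
             exists b' : nat -> R, special_solution n U f F b'))
  /\ ((forall u : R, U u -> 0 < F u) ->
       forall (b : nat -> R) (A B : nat -> R -> R),
         coefficient_functions n U a eps nu F b A B ->
         forall u : R, U u ->
           (forall k : nat, (2 <= k <= n)%nat -> B k u = A k u)
           /\ B 1%nat u = A 1%nat u - a * Rpower (F u) ((INR n - 1) / (INR n - 2))
           /\ B 0%nat u = A 0%nat u
                + a ^ 2 * Rpower (F u) (2 * (INR n - 1) / (INR n - 2))).
Proof.
  assert (HN : 4 <= INR n) by (apply (le_INR 4) in hn; simpl in hn; lra).
  assert (Hnu2 : nu ^ 2 = 1) by (destruct hnu as [-> | ->]; ring).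
  set (c := (INR n - 1) / (INR n - 2)).
  assert (Hc : 0 < c) by (apply Rdiv_lt_0_compat; lra).
  assert (HF' : forall u, U u -> 0 < Derive F u)
    by (intros u Hu; rewrite hF' by exact Hu; apply exp_pos).
  assert (HF'0 : forall u, U u -> Derive F u <> 0)
    by (intros u Hu; apply Rgt_not_eq, HF', Hu).
  assert (Hg : forall u, U u -> g u = F u / (c * Derive F u)).
  { intros u Hu; rewrite hg by exact Hu; unfold c.
    specialize (HF'0 u Hu); field; lra. }
  assert (Hc0 : c <> 0) by lra.
  pose proof (is_derive_quotient U F g c hU Hc0 hF HF'0 Hg) as Dg.
  pose proof (ex_derive_2_quotient U F g c hU Hc0 hF HF'0 Hg) as Dg2.
  assert (Hg' : forall u, U u -> Derive g u =
    (1 - F u * Derive_n F 2 u / Derive F u ^ 2) / c)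
    by (intros u Hu; now apply is_derive_unique, Dg).
  assert (Hgpos : forall u, U u -> 0 < nu * g u).
  { intros u Hu.
    replace (nu * g u) with (Rabs (F u) / (c * Derive F u))
      by (rewrite Hg, hnuF by exact Hu; unfold Rdiv; ring).
    apply Rdiv_lt_0_compat; [now apply Rabs_pos_lt, hF0|].
    now apply Rmult_lt_0_compat; [|apply HF']. }
  set (L := fun v : R => c * ln (Rabs (F v))).
  assert (DL : forall u, U u -> is_derive L u (/ g u)).
  { intros u Hu.
    replace (/ g u) with (c * Derive F u / F u).
    - apply (is_derive_ln_Rabs U F nu c u hU hnuF Hu (hF0 u Hu)).
      apply (hF u Hu 1%nat); auto with arith.
    - rewrite Hg by exact Hu.
      specialize (HF'0 u Hu); specialize (hF0 u Hu); field; tauto. }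
  set (bn := eps * powerRZ c (1 - Z.of_nat n)).
  assert (Hsol : forall b B,
    general_solution n U f F b B <->
    (forall k, (k <= n)%nat -> forall u, U u ->
       normalized nu f L g k u = b k + B k u)).
  { intros b B; now apply general_solution_normalized. }
  assert (Hlead : forall u, U u -> f n u = bn * powerRZ c (Z.of_nat n - 1)
    * Rpower (Rabs (F u)) ((INR n - INR n) / (INR n - 2))
    * powerRZ (Derive F u) (Z.of_nat n - 1)).
  { intros u Hu; apply leading_closed_form; auto. }
  (* The top of the hierarchy is fixed by [F' = |f_n|^(1/(n-1))] alone, before the system is
     considered. *)
  assert (Hnorm : forall u, U u -> normalized nu f L g n u = bn).
  { intros u Hu.
    pose proof (closed_form_weight n n (Rabs (F u)) (Derive F u) hn
      (Rabs_pos_lt _ (hF0 u Hu)) (HF' u Hu)) as W; cbv zeta in W; fold c in W.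
    replace (Rabs (F u) / (c * Derive F u)) with (nu * g u) in W
      by (rewrite Hg, hnuF by exact Hu; unfold Rdiv; ring).
    transitivity (f n u * weight n (L u) (nu * g u)).
    - destruct n as [|[|[|n']]]; reflexivity || lia.
    - rewrite Hlead by exact Hu.
      rewrite <- (Rmult_1_r bn) at 2; rewrite <- W; unfold L; ring. }
  assert (DT : forall u, U u ->
    is_derive (fun v => exp (L v)) u (exp (L u) / g u)).
  { intros u Hu; unfold Rdiv; rewrite Rmult_comm.
    apply (is_derive_comp (V := R_NormedModule)); [apply is_derive_exp|now apply DL]. }
  assert (Hmain : satisfies_system n U a f g <->
     exists (b : nat -> R) (A B : nat -> R -> R),
       coefficient_functions n U a eps nu F b A B
       /\ general_solution n U f F b B).
  { rewrite (system_iff_hierarchy n U nu a f L g hn Hnu2 hf Hgpos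
      (fun u Hu => ex_intro _ _ (Dg u Hu)) Dg2 DL).
    rewrite (hierarchy_solution n U nu a bn (normalized nu f L g)
      (fun v => exp (L v)) (fun u => exp (L u) / g u) hn hU Hnu2 DT Hnorm).
    split.
    - intros (b & Hb & Hs).
      exists b, (fun k u => shift_sum n nu a b k (exp (L u))),
        (fun k u => shift n nu a b k (exp (L u))).
      split; [now apply shift_coefficient_functions|].
      apply Hsol; exact Hs.
    - intros (b & A & B & HAB & Hgen); exists b; split; [apply HAB|].
      intros k Hk u Hu; rewrite (proj1 (Hsol b B) Hgen k Hk u Hu).
      now rewrite (coefficient_functions_shift n U a eps nu F b A B hn HAB u Hu k Hk). }
  split; [exact Hmain|split].
  - intros Ha.
    assert (HB0 : forall (b : nat -> R) (A B : nat -> R -> R),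
      coefficient_functions n U a eps nu F b A B ->
      forall u : R, U u -> forall k : nat, (k <= n)%nat -> B k u = 0).
    { intros b A B HAB u Hu k Hk.
      rewrite (coefficient_functions_shift n U a eps nu F b A B hn HAB u Hu k Hk).
      rewrite Ha; apply shift_a0. }
    split; [exact HB0|]; rewrite Hmain; split.
    + intros (b & A & B & HAB & Hgen).
      (* The powers of [c] are absorbed into the constants; the extra [F' / F] in the formula for
         [f_2] contributes the 1. *)
      exists (fun k => match k with
        | 2%nat => b 2%nat * c + 1
        | _ => b k * powerRZ c (Z.of_nat k - 1)
        end).
      intros u Hu; destruct (Hgen u Hu) as [Hk H2]; split.
      * intros k Hkn Hk2.
        rewrite Hk, (HB0 b A B HAB u Hu k Hkn), Rplus_0_r by assumption.
        destruct k as [|[|[|k]]]; reflexivity || tauto.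
      * rewrite H2, (HB0 b A B HAB u Hu) by lia; fold c; ring.
    + intros (b' & Hb').
      (* This inverts the previous choice, except that [b n] must be the prescribed [bn]; the
         formula for [f n] then comes from [Hlead]. *)
      set (b := fun k => if Nat.eqb k n then bn else
        if Nat.eqb k 2 then (b' 2%nat - 1) / c
        else b' k / powerRZ c (Z.of_nat k - 1)).
      assert (Hbn : b n = bn) by (unfold b; now rewrite Nat.eqb_refl).
      pose proof (shift_coefficient_functions n U a eps nu F b
        (fun v => exp (L v)) hn Hbn (fun u => eq_refl)) as HAB.
      exists b, (fun k u => shift_sum n nu a b k (exp (L u))),
        (fun k u => shift n nu a b k (exp (L u))).
      split; [exact HAB|].
      intros u Hu; destruct (Hb' u Hu) as [Hk H2]; fold c; split.
      * intros k Hkn Hk2.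
        rewrite (HB0 _ _ _ HAB u Hu k Hkn), Rplus_0_r.
        destruct (Nat.eq_dec k n) as [->|Hne].
        -- rewrite Hbn; now apply Hlead.
        -- rewrite Hk by assumption; unfold b.
           rewrite (proj2 (Nat.eqb_neq k n) Hne), (proj2 (Nat.eqb_neq k 2) Hk2).
           field; now apply powerRZ_NOR.
      * rewrite H2, (HB0 _ _ _ HAB u Hu) by lia.
        unfold b; rewrite (proj2 (Nat.eqb_neq 2 n)) by lia; simpl.
        specialize (HF'0 u Hu); specialize (hF0 u Hu).
        field; tauto.
  - intros Hpos b A B [_ HAB] u Hu.
    specialize (Hpos u Hu); destruct (HAB u Hu) as (_ & _ & B3 & B2 & B1 & B0).
    (* With [nu = 1] the factors [1 - nu] remove [b 2] from the corrections. *)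
    assert (Hnu1 : nu = 1).
    { pose proof (hnuF u Hu) as E; rewrite Rabs_pos_eq in E by lra.
      destruct hnu as [-> | ->]; [reflexivity|lra]. }
    rewrite Hnu1, Rabs_pos_eq in * by lra.
    split; [|split].
    + intros k Hk; destruct (Nat.eq_dec k 2) as [->|Hne].
      * rewrite B2; ring.
      * apply B3; lia.
    + rewrite B1; unfold c; ring.
    + rewrite B0; ring.
Qed.
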